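(* Let $\{T_k\}$ be a sequence of NT-statistics built from functions $l_1,l_2,\ldots$ and the observations $Y_1,Y_2,\ldots$, and let $S$ be a selection rule for it with penalty $\pi$ and control sequence $d(n)$. Let $P$ be the alternative distribution of the $Y_i$'s. Suppose that: (1) there exists an integer $K=K(P)\ge 1$ such that $E_P\,l_1(Y)=0,\ldots,E_P\,l_{K-1}(Y)=0$ and $E_P\,l_K(Y)=C_P\neq 0$; (2) there exists a sequence $\{r_n\}_{n=1}^\infty$ with $\lim_{n\to\infty}r_n=\infty$ such that for every $y>0$ $$P\Bigl(\frac1n\Bigl|\sum_{i=1}^n\bigl[l_K(Y_i)-E_P\,l_K(Y_i)\bigr]\Bigr|\ge y\Bigr)=O\Bigl(\frac{1}{r_n}\Bigr)\quad\text{as } n\to\infty ,$$ where the constant in $O(\cdot)$ may depend on $y$; (3) $\lim_{n\to\infty} d(n)=\infty$; (4) $\displaystyle \lim_{n\to\infty}\ \sup_{k\le d(n)} \frac{\pi(k,n)}{n\,\lambda^{(k)}_k}=0$; (5) $d(n)=o(r_n)$ as $n\to\infty$. Then $T_S\to_P\infty$ as $n\to\infty$ (i.e. $P(T_S\le x)\to 0$ for every real $x$).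
   Context: Setting. $Y_1,Y_2,\ldots$ are random variables with values in a measurable space $\mathbb{Y}$ (not necessarily independent), and $l_1,l_2,\ldots:\mathbb{Y}\to\mathbb{R}$ are known measurable functions. $P_0$ is a fixed, known distribution of an auxiliary random variable $Y$ with values in $\mathbb{Y}$, and $E_0$ is expectation with respect to $P_0$. NT-statistics. For each $k$ put $l=(l_1,\ldots,l_k)$ (a row vector) and assume $E_0\,l(Y)=0$ and that the $k\times k$ matrix $L=L_k=\{E_0[l(Y)]^T l(Y)\}^{-1}$ is well defined with finite entries. The NT-statistic based on $Y_1,\ldots,Y_n$ is $$T_k=\Bigl\{\tfrac{1}{\sqrt n}\sum_{j=1}^n l(Y_j)\Bigr\}\,L_k\,\Bigl\{\tfrac{1}{\sqrt n}\sum_{j=1}^n l(Y_j)\Bigr\}^T .$$ The ordered eigenvalues of $L_k$ are $\lambda^{(k)}_1\ge\lambda^{(k)}_2\ge\cdots\ge\lambda^{(k)}_k$. Selection rule. $d(n)$ is a sequence of positive integers (the largest model dimension allowed with $n$ observations). A penalty is a function $\pi:\mathbb{N}\times\mathbb{N}\to\mathbb{R}$ with $\pi(1,n)<\pi(2,n)<\cdots<\pi(d(n),n)$ for all $n$ and $\pi(j,n)-\pi(1,n)\to\infty$ as $n\to\infty$ for every $j=2,\ldots,d(n)$. The selection rule $S$ is $$S=\min\{k:\ 1\le k\le d(n);\ T_k-\pi(k,n)\ge T_j-\pi(j,n),\ j=1,\ldots,d(n)\},$$ and $T_S$ is the corresponding data-driven NT-statistic. Standing assumptions under the alternative. Under $P$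 the variables $Y_1,Y_2,\ldots$ are identically distributed (not necessarily independent); $P$ also denotes probability under the alternative and $E_P$ the corresponding expectation; $E_P\,l(Y)$ exists. With $K$ as in (1) and $l=(l_1,\ldots,l_K)$, the law of large numbers and the multivariate central limit theorem hold: $\frac1n\sum_{j=1}^n l(Y_j)\to E_P\,l(Y)$ in $P$-probability, and $n^{-1/2}\sum_{j=1}^n\bigl(l(Y_j)-E_P\,l(Y)\bigr)\to_d\mathcal{N}$, where $\mathcal{N}$ is a $K$-dimensional normal distribution with zero mean vector.
   Formalization: Condition (4) is taken with |π(k,n)| in place of π(k,n); for penalties with large negative values the claim fails as stated (e.g. K=2, π(1,n)=−n², π(j,n)=j for j≥2, i.i.d. data, d(n) growing slowly), while for nonnegative penalties the two conditions agree. *)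

(* Defs.v *)
From HB Require Import structures.
From mathcomp Require Import all_boot all_order all_algebra.
From mathcomp Require Import all_classical all_reals all_analysis.
Import Order.TTheory GRing.Theory Num.Theory numFieldNormedType.Exports.

Set Implicit Arguments.
Unset Strict Implicit.
Unset Printing Implicit Defensive.

Local Open Scope classical_set_scope.
Local Open Scope ring_scope.

(* Sequences l_1, l_2, ... and Y_1, Y_2, ... are functions on nat used from
   index 1 on; the value at index 0 never matters. *)

Definition is_ordered_spectrum (R : realType) (k : nat) (A : 'M[R]_k)
    (s : seq R) : Prop :=
  sorted >=%R s /\ char_poly A = \prod_(a <- s) ('X - a%:P).

(* Eigenvalues with multiplicity in nonincreasing order; [::] when the
   characteristic polynomial does not split over R, which cannot happen for a
   symmetric matrix. *)
Definition ordered_eigenvalues (R : realType) (k : nat) (A : 'M[R]_k) : seq R :=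
  xget [::] [set s | is_ordered_spectrum A s].

(* j ranges over 1, ..., k *)
Definition ordered_eigenvalue (R : realType) (k : nat) (A : 'M[R]_k) (j : nat)
    : R :=
  (ordered_eigenvalues A)`_j.-1.

Definition score_row (R : realType) (dY : measure_display)
    (Yt : measurableType dY) (l : nat -> {mfun Yt >-> R}) (k : nat) (y : Yt)
    : 'rV[R]_k :=
  \row_(i < k) l i.+1 y.

(* entrywise expectation of (l_1, ..., l_k)^T (l_1, ..., l_k) *)
Definition score_second_moment (R : realType) (dY : measure_display)
    (Yt : measurableType dY) (P0 : probability Yt R)
    (l : nat -> {mfun Yt >-> R}) (k : nat) : 'M[R]_k :=
  \matrix_(i < k, j < k) fine 'E_P0[fun y => (l i.+1 y * l j.+1 y)%R]%E.

Definition NT_scores (R : realType) (dY : measure_display)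
    (Yt : measurableType dY) (P0 : probability Yt R)
    (l : nat -> {mfun Yt >-> R}) : Prop :=
  [/\ forall i, (0 < i)%N ->
        P0.-integrable setT (EFin \o l i) /\ 'E_P0[l i]%E = 0%E,
      forall i j, (0 < i)%N -> (0 < j)%N ->
        P0.-integrable setT (fun y => (l i y * l j y)%:E) &
      forall k, (0 < k)%N -> score_second_moment P0 l k \in unitmx].

Definition NT_matrix (R : realType) (dY : measure_display)
    (Yt : measurableType dY) (P0 : probability Yt R)
    (l : nat -> {mfun Yt >-> R}) (k : nat) : 'M[R]_k :=
  invmx (score_second_moment P0 l k).

Definition NT_stat (R : realType) (dY : measure_display)
    (Yt : measurableType dY) (P0 : probability Yt R)
    (l : nat -> {mfun Yt >-> R}) (Omega : Type) (Y : nat -> Omega -> Yt)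
    (k n : nat) (w : Omega) : R :=
  let v := (Num.sqrt n%:R)^-1 *: \sum_(1 <= j < n.+1) score_row l k (Y j w) in
  (v *m NT_matrix P0 l k *m v^T) 0 0.

(* Since d n --> +oo is assumed where this is used, every fixed j >= 2 satisfies
   j <= d n for all large n. *)
Definition is_penalty (R : realType) (d : nat -> nat) (pen : nat -> nat -> R)
    : Prop :=
  (forall n, (0 < n)%N -> forall i j, (1 <= i)%N -> (i < j)%N -> (j <= d n)%N ->
     pen i n < pen j n) /\
  (forall j, (2 <= j)%N -> pen j n - pen 1%N n @[n --> \oo] --> +oo).

(* Head of the increasing list of the maximizers of T_k - pen(k, n) over
   1 <= k <= d n, i.e. the least maximizer; the list is nonempty if 0 < d n. *)
Definition selection_rule (R : realType) (Omega : Type) (d : nat -> nat)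
    (pen : nat -> nat -> R) (T : nat -> nat -> Omega -> R) (n : nat) (w : Omega)
    : nat :=
  head 0%N [seq k <- iota 1 (d n) |
    all (fun j => T j n w - pen j n <= T k n w - pen k n) (iota 1 (d n))].

Definition cvg_in_probability (R : realType) (dO : measure_display)
    (Omega : measurableType dO) (Pr : probability Omega R)
    (V : normedZmodType R) (X : nat -> Omega -> V) (c : V) : Prop :=
  forall e : R, 0 < e ->
    Pr [set w | e <= `|X n w - c|] @[n --> \oo] --> 0%E.

Definition cvg_in_probability_pinfty (R : realType) (dO : measure_display)
    (Omega : measurableType dO) (Pr : probability Omega R)
    (X : nat -> Omega -> R) : Prop :=
  forall x : R, Pr [set w | X n w <= x] @[n --> \oo] --> 0%E.

Definition borel_rV (R : realType) (k : nat) :=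
  g_sigma_algebraType (@open 'rV[R]_k).

Definition cvg_in_distribution (R : realType) (dO : measure_display)
    (Omega : measurableType dO) (Pr : probability Omega R) (k : nat)
    (X : nat -> Omega -> 'rV[R]_k) (nu : probability (borel_rV R k) R) : Prop :=
  forall f : 'rV[R]_k -> R, continuous f -> (exists M, forall x, `|f x| <= M) ->
    'E_Pr[f \o X n]%E @[n --> \oo] --> (\int[nu]_x (f x)%:E)%E.

(* N(0, s^2) on the line; normal_prob 0 0 is not the point mass at 0, so the
   degenerate case is treated separately. *)
Definition centered_normal1 (R : realType) (s : R) (A : set R) : \bar R :=
  if s == 0 then \d_(0 : R) A else normal_prob 0 s A.

(* All linear functionals are centered normal; singular covariances allowed. *)
Definition is_centered_normal (R : realType) (k : nat)
    (nu : probability (borel_rV R k) R) : Prop :=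
  forall a : 'cV[R]_k, exists s : R,
    forall A : set R, measurable A ->
      nu [set x : 'rV[R]_k | A ((x *m a) 0 0)] = centered_normal1 s A.

(* Main.v *)
Require Import Defs.
From mathcomp Require Import all_boot all_order all_algebra.
From mathcomp Require Import all_classical all_reals all_analysis.
From mathcomp Require Import measurable_realfun complex ring lra.
Import Order.TTheory GRing.Theory Num.Theory numFieldNormedType.Exports.

(** The empirical means are controlled by the law of large numbers; everything
else is deterministic.  Fix a level x and write m for the empirical mean of
(l_1, ..., l_K).  With probability tending to 1, m is within a small e of
its expectation, so that m_1
is within e of E_P l_1 and m_K is within e of C_P.  On that event T_S > x for
all large n ([selected_stat_gt]).

If S >= 2, then comparing S with the dimension 1 in the selection rule gives
T_S >= T_1 + pen(S, n) - pen(1, n) >= pen(2, n) - pen(1, n), because T_1 >= 0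
and the penalty increases; the right-hand side tends to infinity.

If S = 1, two facts about the statistics matter.  By Cauchy-Schwarz for the
second-moment form, n * m_K ^ 2 is at most a constant times T_K
([sqr_entry_le_invmx_form], [NT_stat_linear_growth]), so T_K >= c * n for some
c > 0.  When K = 1 this already bounds T_S = T_1 from below.  When K > 1 the
expectation of l_1 vanishes, so T_1 = n * m_1 ^ 2 * L_1 is at most c * n / 4,
while both pen(1, n) and pen(K, n) are at most c * n / 4 in absolute value for
large n ([penalty_le_linear]); then dimension K beats dimension 1 and S = 1 is
impossible.

Reading pen(k, n) = o(n) off the assumption on the penalty requires the
smallest eigenvalue of L_k to be positive, as a bound on the ratio is void
otherwise.  The eigenvalues are roots listed from a splitting of the
characteristic polynomial, so one has to know that it splits over the reals:
this comes from the spectral theorem for Hermitian matrices over R[i]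
([symmetric_ordered_spectrum], [ordered_eigenvalue_gt0]).

Passing from the inclusion of events to an inequality between probabilities
uses that {T_S <= x} is measurable ([measurable_selected_le]). *)

Set Implicit Arguments.
Unset Strict Implicit.

Local Open Scope classical_set_scope.
Local Open Scope ring_scope.

(** * Spectrum of a real symmetric matrix *)

Lemma char_poly_conj (F : comUnitRingType) n (P D : 'M[F]_n) :
  P \in unitmx -> char_poly (invmx P *m D *m P) = char_poly D.
Proof.
move=> Pu; rewrite /char_poly /char_poly_mx.
have PVP : map_mx polyC (invmx P) *m map_mx polyC P = 1%:M.
  by rewrite -map_mxM mulVmx// map_mx1.
have -> : 'X%:M - map_mx polyC (invmx P *m D *m P) =
    map_mx polyC (invmx P) *m ('X%:M - map_mx polyC D) *m map_mx polyC P.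
  rewrite !map_mxM mulmxBr mulmxBl; congr (_ - _).
  by rewrite mul_mx_scalar -scalemxAl PVP scalemx1.
by rewrite !det_mulmx mulrAC -det_mulmx PVP det1 mul1r.
Qed.

Lemma char_poly_diag (F : comNzRingType) n (D : 'rV[F]_n) :
  char_poly (diag_mx D) = \prod_i ('X - (D 0 i)%:P).
Proof.
rewrite char_poly_trig ?diag_mx_is_trig//.
by apply: eq_bigr => i _; rewrite !mxE eqxx.
Qed.

(** Over R[i] the matrix is Hermitian, hence unitarily similar to a diagonal
matrix with real entries; those entries are the roots over R. *)
Lemma symmetric_ordered_spectrum (R : realType) n (A : 'M[R]_n) :
  A^T = A -> exists s, is_ordered_spectrum A s.
Proof.
move=> AT.
pose toC : {rmorphism R -> R[i]} := real_complex R.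
pose B := map_mx toC A.
have realC (x : R) : toC x \is Num.real.
  by rewrite complex_real.
have Bh : B \is hermsymmx.
  apply: realsym_hermsym; last by apply/mxOverP => i j; rewrite mxE.
  by apply/is_hermitianmxP; rewrite expr0 scale1r map_mx_id// /B map_trmx AT.
have sp_real := mxOverP (hermitian_spectral_diag_real Bh).
have /orthomx_spectralP Bsp := hermitian_normalmx Bh.
pose t i := complex.Re (spectral_diag B 0 i).
have tE i : spectral_diag B 0 i = toC (t i).
  by rewrite /t /toC /= RRe_real.
have AE : char_poly A = \prod_i ('X - (t i)%:P).
  apply: (@map_poly_inj _ _ toC).
  rewrite map_char_poly -/B Bsp char_poly_conj ?spectral_unit//.
  rewrite char_poly_diag rmorph_prod; apply: eq_bigr => i _.
  by rewrite tE rmorphB /= map_polyX map_polyC.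
exists (sort >=%R [seq t i | i <- enum 'I_n]); split.
  by apply: sort_sorted => x y; exact: ge_total.
rewrite AE (perm_big _ (permEl (perm_sort _ _))) /= big_map.
by rewrite big_enum.
Qed.

(** If v is an eigenvector for a, then a * |v| ^ 2 = v A v^T >= 0, and a <> 0
since A is invertible. *)
Lemma ordered_eigenvalue_gt0 (R : realType) n (A : 'M[R]_n) j :
  A^T = A -> A \in unitmx -> (forall u : 'rV_n, 0 <= (u *m A *m u^T) 0 0) ->
  (j.-1 < n)%N -> 0 < ordered_eigenvalue A j.
Proof.
move=> AT Au A_ge0 jn.
have [_ AE] := xgetPex [::] (symmetric_ordered_spectrum AT).
have size_ev : size (ordered_eigenvalues A) = n.
  by apply: succn_inj; rewrite -(size_char_poly A) AE size_prod_XsubC.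
rewrite /ordered_eigenvalue; set a := _`_j.-1.
have : eigenvalue A a.
  by rewrite eigenvalue_root_char AE root_prod_XsubC mem_nth ?size_ev.
move=> /eigenvalueP[v vA v0].
have vv_gt0 : 0 < (v *m v^T) 0 0.
  have [i vi0] := rV0Pn _ v0.
  rewrite mxE (bigD1 i)//= ltr_wpDr//.
    by apply: sumr_ge0 => k _; rewrite mxE -expr2 sqr_ge0.
  by rewrite mxE -expr2 exprn_even_gt0.
rewrite lt_neqAle -(pmulr_lge0 _ vv_gt0) andbC; apply/andP; split.
  by have := A_ge0 v; rewrite vA -scalemxAl mxE.
apply: contraNneq v0 => a0.
by rewrite -(mulmxK Au v) vA -a0 scale0r mul0mx.
Qed.

(** * Cauchy-Schwarz for a positive semidefinite form and its inverse *)

Lemma quadratic_ge0_discr (R : realFieldType) (a b c : R) : 0 <= c ->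
  (forall t, 0 <= a - 2 * t * b + t ^+ 2 * c) -> b ^+ 2 <= c * a.
Proof.
rewrite le_eqVlt => /predU1P[<-|c0] q0.
  have [->|b0] := eqVneq b 0; first by rewrite expr0n mul0r.
  (* c = 0: the affine function a - 2 b t takes the value -1 at this t *)
  have := q0 ((a + 1) / (2 * b)).
  have -> : a - 2 * ((a + 1) / (2 * b)) * b + ((a + 1) / (2 * b)) ^+ 2 * 0 = - 1.
    by field.
  by rewrite oppr_ge0 ler10.
(* b / c minimizes the quadratic *)
have := q0 (b / c).
have -> : a - 2 * (b / c) * b + (b / c) ^+ 2 * c = (c * a - b ^+ 2) / c.
  by field; rewrite gt_eqF.
by rewrite pmulr_lge0 ?invr_gt0// subr_ge0.
Qed.

(** With u = v M^-1 and e_i the i-th basis vector, v_i is the M-product of u and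
e_i, while M i i and v M^-1 v^T are their M-squares. *)
Lemma sqr_entry_le_invmx_form (R : realFieldType) k (M : 'M[R]_k)
    (v : 'rV_k) (i : 'I_k) :
  M^T = M -> M \in unitmx -> (forall u : 'rV_k, 0 <= (u *m M *m u^T) 0 0) ->
  v 0 i ^+ 2 <= M i i * (v *m invmx M *m v^T) 0 0.
Proof.
move=> MT Mu M_ge0.
have Mii : (delta_mx 0 i : 'rV_k) *m M *m (delta_mx 0 i : 'rV_k)^T = (M i i)%:M.
  by rewrite -rowE trmx_delta -colE; apply/matrixP => p q; rewrite !ord1 !mxE.
apply: quadratic_ge0_discr => [|t].
  by have := M_ge0 (delta_mx 0 i); rewrite Mii mxE.
have := M_ge0 (v *m invmx M - t *: delta_mx 0 i).
rewrite mulmxBl mulmxKV// linearB /= mulmxBr !mulmxBl.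
rewrite trmx_mul trmx_inv MT linearZ /=.
rewrite -!scalemxAl -!scalemxAr Mii trmx_delta -colE.
rewrite -(mulmxA _ M) (mulmxA M) mulmxV// mul1mx.
rewrite -rowE mulmxA !mxE eqxx mulr1n => /le_trans; apply.
by lra.
Qed.

(** * NT-statistics *)

Section nt_stat.
Context (R : realType) (dY : measure_display) (Yt : measurableType dY).
Variables (P0 : probability Yt R) (l : nat -> {mfun Yt >-> R}).
Hypothesis hl : NT_scores P0 l.

Lemma score_second_moment_sym k :
  (score_second_moment P0 l k)^T = score_second_moment P0 l k.
Proof.
apply/matrixP => i j; rewrite !mxE; congr (fine 'E_P0[_]).
by apply/funext => y; rewrite mulrC.
Qed.

(** The form is E_0 (u_1 l_1 + ... + u_k l_k) ^ 2. *)
Lemma score_second_moment_ge0 k (u : 'rV_k) :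
  0 <= (u *m score_second_moment P0 l k *m u^T) 0 0.
Proof.
case: hl => _ lint _.
rewrite -lee_fin.
pose f (p : 'I_k * 'I_k) y : \bar R :=
  ((u 0 p.1 * u 0 p.2)%:E * (l p.1.+1 y * l p.2.+1 y)%:E)%E.
have fint p : P0.-integrable setT (f p) by apply: integrableZl => //; exact: lint.
have -> : ((u *m score_second_moment P0 l k *m u^T) 0 0)%:E =
    (\int[P0]_y \sum_(p : 'I_k * 'I_k) f p y)%E.
  rewrite integral_sum// -(pair_bigA _ (fun i j => \int[P0]_y f (i, j) y)%E) /=.
  rewrite exchange_big /= mxE -sumEFin; apply: eq_bigr => j _.
  rewrite !mxE mulr_suml -sumEFin; apply: eq_bigr => i _.
  rewrite integralZl//; last exact: lint.
  rewrite mulrAC EFinM !mxE unlock fineK//.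
  by apply: integrable_fin_num => //; exact: lint.
apply: integral_ge0 => y _.
rewrite -(pair_bigA _ (fun i j => f (i, j) y)) /=.
have -> : (\sum_i \sum_j f (i, j) y)%E = ((\sum_i u 0 i * l i.+1 y) ^+ 2)%:E.
  rewrite expr2 mulr_suml -sumEFin; apply: eq_bigr => i _.
  rewrite mulr_sumr -sumEFin; apply: eq_bigr => j _.
  by rewrite /f -EFinM mulrACA.
by rewrite lee_fin sqr_ge0.
Qed.

Lemma score_second_moment_unit k : (0 < k)%N ->
  score_second_moment P0 l k \in unitmx.
Proof. by case: hl => _ _; exact. Qed.

Lemma NT_matrix_sym k : (NT_matrix P0 l k)^T = NT_matrix P0 l k.
Proof. by rewrite /NT_matrix trmx_inv score_second_moment_sym. Qed.

(** With M = L_k^-1 one has L_k = L_k M L_k, so the form of L_k at u is the form of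
M at u L_k. *)
Lemma NT_matrix_ge0 k (u : 'rV_k) : (0 < k)%N ->
  0 <= (u *m NT_matrix P0 l k *m u^T) 0 0.
Proof.
move=> k0.
have := score_second_moment_ge0 (u *m NT_matrix P0 l k).
rewrite {2}/NT_matrix mulmxKV ?score_second_moment_unit//.
by rewrite trmx_mul NT_matrix_sym mulmxA.
Qed.

Lemma NT_eigenvalue_gt0 k : (0 < k)%N ->
  0 < ordered_eigenvalue (NT_matrix P0 l k) k.
Proof.
move=> k0; apply: ordered_eigenvalue_gt0.
- exact: NT_matrix_sym.
- by rewrite unitmx_inv score_second_moment_unit.
- by move=> u; exact: NT_matrix_ge0.
- by rewrite prednK.
Qed.

Context (Omega : Type) (Y : nat -> Omega -> Yt).

Definition score_mean k n w : 'rV[R]_k :=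
  n%:R^-1 *: \sum_(1 <= j < n.+1) score_row l k (Y j w).

Lemma score_meanE k n w (i : 'I_k) :
  score_mean k n w 0 i = n%:R^-1 * \sum_(1 <= j < n.+1) l i.+1 (Y j w).
Proof.
rewrite /score_mean mxE summxE; congr (_ * _).
by apply: eq_bigr => j _; rewrite mxE.
Qed.

Lemma NT_statE k n w : (0 < n)%N -> NT_stat P0 l Y k n w =
  n%:R * (score_mean k n w *m NT_matrix P0 l k *m (score_mean k n w)^T) 0 0.
Proof.
move=> n0; rewrite /NT_stat /score_mean; set s := \sum_(_ <= _ < _) _.
rewrite !linearZ /= -!scalemxAl !mxE !mulrA; congr (_ * _).
have n0' : n%:R != 0 :> R by rewrite pnatr_eq0 -lt0n.
by rewrite mulfV// mul1r -expr2 exprVn sqr_sqrtr.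
Qed.

Lemma NT_stat_ge0 k n w : (0 < k)%N -> 0 <= NT_stat P0 l Y k n w.
Proof. exact: NT_matrix_ge0. Qed.

Lemma NT_stat_ge k n w (i : 'I_k) : (0 < n)%N ->
  n%:R * score_mean k n w 0 i ^+ 2 <=
    score_second_moment P0 l k i i * NT_stat P0 l Y k n w.
Proof.
move=> n0; rewrite NT_statE// [leRHS]mulrCA ler_wpM2l//.
apply: sqr_entry_le_invmx_form; first exact: score_second_moment_sym.
- by apply: score_second_moment_unit; case: k i => // -[].
- by move=> u; exact: score_second_moment_ge0.
Qed.

Lemma NT_stat1E n w : (0 < n)%N -> NT_stat P0 l Y 1 n w =
  n%:R * (score_mean 1 n w 0 0 ^+ 2 * NT_matrix P0 l 1 0 0).
Proof.
move=> n0; rewrite NT_statE//; set m := score_mean _ _ _.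
by rewrite mxE big_ord1 mxE big_ord1 [m^T _ _]mxE; ring.
Qed.

(** By [NT_stat_ge] one would take the inverse of the i-th diagonal entry of the
second-moment matrix; adding 1 to that entry avoids arguing that it is not 0. *)
Lemma NT_stat_linear_growth k (i : 'I_k) : exists2 b : R, 0 < b &
  forall n w, (0 < n)%N -> b * score_mean k n w 0 i ^+ 2 * n%:R <=
    NT_stat P0 l Y k n w.
Proof.
set m := score_second_moment P0 l k i i.
have k0 : (0 < k)%N by case: k i {m} => // -[].
have m0 : 0 <= m.
  have := score_second_moment_ge0 (delta_mx 0 i).
  by rewrite trmx_delta -rowE -colE 2!mxE.
have m1 : 0 < m + 1 by rewrite ltr_wpDl.
exists (m + 1)^-1; first by rewrite invr_gt0.
move=> n w n0; rewrite -mulrA ler_pdivrMl// [leLHS]mulrC.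
apply: le_trans (NT_stat_ge w i n0) _.
by rewrite ler_wpM2r ?NT_stat_ge0// lerDl.
Qed.

End nt_stat.

Section nt_stat_measurable.
Context (R : realType) (dY : measure_display) (Yt : measurableType dY).
Context (dO : measure_display) (Omega : measurableType dO).
Variables (P0 : probability Yt R) (l : nat -> {mfun Yt >-> R}).
Variables (Pr : probability Omega R) (Y : nat -> {RV Pr >-> Yt}).

Lemma measurable_score_mean k n (i : 'I_k) :
  measurable_fun setT (fun w => score_mean l Y k n w 0 i).
Proof.
under eq_fun do rewrite score_meanE.
apply: measurable_funM => //; apply: measurable_sum => j.
exact: measurableT_comp.
Qed.

Lemma measurable_NT_stat k n :
  measurable_fun setT (NT_stat P0 l Y k n).
Proof.
have mv (i : 'I_k) : measurable_fun setT (fun w =>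
    ((Num.sqrt n%:R)^-1 *: \sum_(1 <= j < n.+1) score_row l k (Y j w)) 0 i).
  under eq_fun => w.
    rewrite mxE summxE; under eq_bigr do rewrite mxE; over.
  apply: measurable_funM => //; apply: measurable_sum => j.
  exact: measurableT_comp.
rewrite /NT_stat.
under eq_fun => w.
  rewrite mxE; under eq_bigr => j _.
    rewrite mxE [X in _ * X]mxE; over.
  over.
apply: measurable_sum => j; apply: measurable_funM => //.
by apply: measurable_sum => i; apply: measurable_funM.
Qed.

End nt_stat_measurable.

(** * Selection rule and penalty *)

Lemma selection_ruleP (R : realType) (Omega : Type) (d : nat -> nat)
    (pen : nat -> nat -> R) (T : nat -> nat -> Omega -> R) n w
    (S := selection_rule d pen T n w) :
  (0 < d n)%N -> (1 <= S <= d n)%N /\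
  (forall j, (1 <= j <= d n)%N -> T j n w - pen j n <= T S n w - pen S n).
Proof.
move=> d0; pose i0 := Ordinal d0.
pose F (i : 'I_(d n)) := T i.+1 n w - pen i.+1 n.
pose best k := all (fun j => T j n w - pen j n <= T k n w - pen k n)
  (iota 1 (d n)).
have best_ex : has best (iota 1 (d n)).
  have [i _ imax] := @Order.TotalTheory.arg_maxP _ R _ i0 xpredT F isT.
  apply/hasP; exists i.+1; first by rewrite mem_iota /= add1n ltnS ltn_ord.
  apply/allP => j; rewrite mem_iota add1n ltnS => /andP[j0 jd].
  have jd' : (j.-1 < d n)%N by rewrite prednK.
  by have := imax (Ordinal jd') isT; rewrite /F /= prednK.
have : S \in [seq k <- iota 1 (d n) | best k].
  rewrite /S /selection_rule -/best; move: best_ex.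
  by rewrite has_filter; case: (seq.filter _ _) => //= k s _; rewrite mem_head.
rewrite mem_filter mem_iota add1n ltnS => /andP[/allP Smax Sd].
by split=> // j jd; apply: Smax; rewrite mem_iota add1n ltnS.
Qed.

(** Each ratio is at most the supremum, since the index set is finite; k is
admissible as soon as k <= d n. *)
Lemma penalty_le_linear (R : realType) (d : nat -> nat) (pen : nat -> nat -> R)
    (lam : nat -> R) k (c : R) :
  d n @[n --> \oo] --> \oo ->
  sup [set `|pen k n| / (n%:R * lam k) | k in [set k | (1 <= k <= d n)%N]]
    @[n --> \oo] --> 0 ->
  (1 <= k)%N -> 0 < lam k -> 0 < c ->
  \forall n \near \oo, `|pen k n| <= c * n%:R.
Proof.
move=> d_oo sup0 k1 lk c0.
have cl : 0 < c / lam k by rewrite divr_gt0.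
have dk : \forall n \near \oo, (k <= d n)%N.
  by apply: (d_oo [set m | (k <= m)%N]); exact: nbhs_infty_ge.
have sup_small : \forall n \near \oo, `|sup [set `|pen k n| / (n%:R * lam k)
    | k in [set k | (1 <= k <= d n)%N]]| <= c / lam k.
  exact: cvgr0_norm_le sup0 _ cl.
near=> n.
have n0 : 0 < n%:R :> R by rewrite ltr0n; near: n; exact: nbhs_infty_gt.
have kd : (k <= d n)%N by near: n.
pose A := [set `|pen k n| / (n%:R * lam k) | k in [set k | (1 <= k <= d n)%N]].
have supA : sup A <= c / lam k.
  by apply: le_trans (ler_norm _) _; rewrite /A; near: n.
have Aub : has_ubound A.
  exists (\sum_(i < (d n).+1) `| `|pen i n| / (n%:R * lam i)|) => _ [i /= id <-].
  have id' : (i < (d n).+1)%N by case/andP: id.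
  rewrite (bigD1 (Ordinal id'))//= (le_trans (ler_norm _))// lerDl.
  exact: sumr_ge0.
have kA : A (`|pen k n| / (n%:R * lam k)) by exists k => //=; rewrite k1.
have := le_trans (ub_le_sup Aub kA) supA.
rewrite ler_pdivrMr ?mulr_gt0//; congr (_ <= _).
by field; rewrite gt_eqF.
Unshelve. all: by end_near. Qed.

(** * Measurability *)

Lemma row_normE (R : realType) m (v : 'rV[R]_m) :
  `|v| = \big[Order.max/0]_ij `|v ij.1 ij.2|.
Proof. exact: mx_normrE. Qed.

Lemma ler_norm_entry (R : realType) m (v : 'rV[R]_m) i : `|v 0 i| <= `|v|.
Proof. by rewrite row_normE; apply/bigmax_geP; right; exists (0, i). Qed.

Section measurability.
Context (dO : measure_display) (Omega : measurableType dO).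

Lemma measurable_all (s : seq nat) (p : nat -> Omega -> bool) :
  (forall j, measurable [set w | p j w]) ->
  measurable [set w | all (p ^~ w) s].
Proof.
move=> mp; elim: s => [|a s IH] /=.
  by rewrite (_ : [set _ | _] = setT)//; apply/seteqP; split.
rewrite (_ : [set _ | _] = [set w | p a w] `&` [set w | all (p ^~ w) s]).
  exact: measurableI.
by apply/seteqP; split => w /=; [move/andP|move=> ?; apply/andP].
Qed.

(** The head of a filtered list ranges over a fixed finite set, and which item it
is depends on finitely many events.  The set-valued G makes the event depend on
w also through the value selected. *)
Lemma measurable_head_filter (s : seq nat) (p : nat -> Omega -> bool)
    (G : nat -> set Omega) x0 :
  (forall j, measurable [set w | p j w]) -> (forall k, measurable (G k)) ->
  measurable [set w | G (head x0 [seq k <- s | p k w]) w].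
Proof.
move=> mp mG; elim: s => [|a s IH] /=; first exact: mG.
rewrite (_ : [set _ | _] = ([set w | p a w] `&` G a) `|`
  (~` [set w | p a w] `&` [set w | G (head x0 [seq k <- s | p k w]) w])).
  apply: measurableU; apply: measurableI => //; exact: measurableC.
apply/seteqP; split => w /=.
  by case: ifPn => pa H; [left|right; split=> //; exact/negP].
by case=> -[+ H]; [move=> ->|move/negP/negbTE => ->].
Qed.

Lemma measurable_selected_le (R : realType) (d : nat -> nat)
    (pen : nat -> nat -> R) (T : nat -> nat -> Omega -> R) n x :
  (forall k, measurable_fun setT (T k n)) ->
  measurable [set w | T (selection_rule d pen T n w) n w <= x].
Proof.
move=> mT; rewrite /selection_rule.
have mle (f g : Omega -> R) : measurable_fun setT f -> measurable_fun setT g ->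
    measurable [set w | f w <= g w].
  by move=> mf mg; rewrite -[X in measurable X]setTI; exact: measurable_fun_le.
apply: (@measurable_head_filter _
  (fun k w => all (fun j => T j n w - pen j n <= T k n w - pen k n) _)
  (fun k => [set w | T k n w <= x])) => [k|k].
  apply: (@measurable_all _
    (fun j w => T j n w - pen j n <= T k n w - pen k n)) => j.
  by apply: mle; exact: measurable_funB.
exact: mle.
Qed.

Lemma measurable_mx_norm_ge (R : realType) m (f : Omega -> 'rV[R]_m) (e : R) :
  0 < e -> (forall i, measurable_fun setT (fun w => f w 0 i)) ->
  measurable [set w | e <= `|f w|].
Proof.
move=> e0 mf.
rewrite (_ : [set _ | _] = \bigcup_(i in [set: 'I_m]) [set w | e <= `|f w 0 i|]).
  apply: fin_bigcup_measurable => [|i _]; first exact: finite_finset.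
  rewrite -[X in measurable X]setTI; apply: measurable_fun_le => //.
  exact: measurableT_comp.
apply/seteqP; split => w /=; rewrite row_normE.
  move=> /bigmax_geP[|[[i j] _ /=]]; first by rewrite leNgt e0.
  by rewrite (ord1 i); exists j.
by move=> [j _ /= ej]; apply/bigmax_geP; right; exists (0, j).
Qed.

End measurability.

(** * Divergence of the selected statistic *)

(** If S >= 2, the penalty gap forces T_S above x.  If S = 1 < K, then
g <= T_K <= T_1 + pen(K, n) - pen(1, n) <= 3 g / 4 is absurd, whence the
quarters.  In the application g is of order n. *)
Lemma selected_stat_gt (R : realType) (Omega : Type) (d : nat -> nat)
    (pen : nat -> nat -> R) (T : nat -> nat -> Omega -> R) n w K (x g : R) :
  (forall i j, (1 <= i)%N -> (i < j)%N -> (j <= d n)%N -> pen i n < pen j n) ->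
  (1 <= K <= d n)%N -> x < g -> 0 < g ->
  x < pen 2%N n - pen 1%N n -> 0 <= T 1%N n w ->
  g <= T K n w -> ((1 < K)%N -> T 1%N n w <= g / 4) ->
  `|pen 1%N n| <= g / 4 -> `|pen K n| <= g / 4 ->
  x < T (selection_rule d pen T n w) n w.
Proof.
move=> pen_mono Kd xg g0 x_pen T1_ge0 TK T1 pen1 penK.
have d0 : (0 < d n)%N by case/andP: Kd; exact: leq_trans.
have [] := selection_ruleP pen T w d0; set S := selection_rule _ _ _ _ _.
move=> /andP[]; rewrite leq_eqVlt => /predU1P[<- _|S2 Sd] Smax.
  have [K1|K1] := ltnP 1 K; last first.
    have KE : K = 1%N by apply/eqP; rewrite eqn_leq K1; case/andP: Kd.
    by rewrite KE in TK; exact: lt_le_trans TK.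
  have := Smax _ Kd; have := T1 K1.
  move: pen1 penK; rewrite !ler_norml => /andP[? ?] /andP[? ?] ? ?; lra.
have pen2S : pen 2%N n <= pen S n.
  move: S2; rewrite leq_eqVlt => /predU1P[<-//|S2].
  by apply: ltW; exact: pen_mono.
have := Smax 1%N; rewrite d0 => /(_ isT); lra.
Qed.

Unset Implicit Arguments.
Set Strict Implicit.

Theorem theorem1 (R : realType)
  (dY : measure_display) (Yt : measurableType dY)
  (P0 : probability Yt R) (l : nat -> {mfun Yt >-> R})
  (hl : NT_scores P0 l)
  (d : nat -> nat) (hd0 : forall n, (0 < n)%N -> (0 < d n)%N)
  (pen : nat -> nat -> R) (hpen : is_penalty d pen)
  (dO : measure_display) (Omega : measurableType dO)
  (Pr : probability Omega R) (Y : nat -> {RV Pr >-> Yt})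
  (P : probability Yt R)
  (hY : forall j, (0 < j)%N ->
    forall A, measurable A -> distribution Pr (Y j) A = P A)
  (hEl : forall i, (0 < i)%N -> P.-integrable setT (EFin \o l i))
  (K : nat) (hK : (1 <= K)%N)
  (hE0 : forall i, (1 <= i)%N -> (i < K)%N -> 'E_P[l i]%E = 0%E)
  (hEK : 'E_P[l K]%E <> 0%E)
  (hLLN : cvg_in_probability Pr
     (fun n w => n%:R^-1 *: \sum_(1 <= j < n.+1) score_row l K (Y j w))
     (\row_(i < K) fine 'E_P[l i.+1]%E))
  (hCLT : exists2 nu : probability (borel_rV R K) R, is_centered_normal nu &
     cvg_in_distribution Pr
       (fun n w => (Num.sqrt n%:R)^-1 *:
          \sum_(1 <= j < n.+1)
             (score_row l K (Y j w) - \row_(i < K) fine 'E_P[l i.+1]%E))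
       nu)
  (r : nat -> R) (hr : r n @[n --> \oo] --> +oo)
  (h2 : forall y : R, 0 < y ->
     (fun n => fine (Pr [set w |
        y <= n%:R^-1 *
          `|\sum_(1 <= j < n.+1) (l K (Y j w) - fine 'E_Pr[l K \o Y j]%E)|]))
     =O_\oo (fun n => (r n)^-1))
  (h3 : d n @[n --> \oo] --> \oo)
  (h4 : sup [set `|pen k n| / (n%:R * ordered_eigenvalue (NT_matrix P0 l k) k)
              | k in [set k | (1 <= k <= d n)%N]] @[n --> \oo] --> 0)
  (h5 : (fun n => (d n)%:R : R) =o_\oo r) :
  cvg_in_probability_pinfty Pr
    (fun n w =>
       NT_stat P0 l Y (selection_rule d pen (NT_stat P0 l Y) n w) n w).
Proof.
move=> x.
case: hpen => pen_mono pen_oo.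
have EK_fin : 'E_P[l K]%E \is a fin_num.
  by rewrite unlock; apply: integrable_fin_num => //; exact: hEl.
pose C := fine 'E_P[l K]%E.
have C0 : 0 < `|C|.
  rewrite normr_gt0; apply/eqP => C0; apply: hEK.
  by rewrite -[LHS]fineK// -/C C0.
have Km : (K.-1 < K)%N by rewrite prednK.
pose iK := Ordinal Km; pose i1 := Ordinal hK.
have [b b0 TK_ge] := NT_stat_linear_growth hl Y iK.
(* |m_K| >= |C| / 2 on the good event, so T_K >= c * n there *)
pose c := b * (C / 2) ^+ 2.
have c0 : 0 < c.
  by rewrite mulr_gt0// exprn_even_gt0//= mulf_neq0 ?invr_neq0// -normr_gt0.
pose L1 := NT_matrix P0 l 1 0 0.
(* the first bound gives |m_K| >= |C| / 2; the last two, with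
   m_1 ^ 2 <= |m_1| <= e, give T_1 <= c * n / 4 when E_P l_1 = 0 *)
pose e := Num.min (`|C| / 2) (Num.min 1 (c / 4 / (`|L1| + 1))).
have L10 : 0 < `|L1| + 1 by rewrite ltr_wpDl.
have e0 : 0 < e by rewrite !lt_min ltr01 !divr_gt0.
pose mean n w := score_mean l Y K n w.
pose mu : 'rV[R]_K := \row_(i < K) fine 'E_P[l i.+1]%E.
have mean_cvg : Pr [set w | e <= `|mean n w - mu|] @[n --> \oo] --> 0%E.
  exact: hLLN e e0.
have pen_small k : (1 <= k)%N -> \forall n \near \oo, `|pen k n| <= c / 4 * n%:R.
  move=> k1; apply: (penalty_le_linear h3 h4 k1 (NT_eigenvalue_gt0 hl k1)).
  by rewrite divr_gt0.
apply: (squeeze_cvge _ _ mean_cvg); last exact: cvg_cst.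
have pen1_small := pen_small 1%N isT.
have penK_small := pen_small K hK.
have dK : \forall n \near \oo, (K <= d n)%N.
  by apply: (h3 [set m | (K <= m)%N]); exact: nbhs_infty_ge.
have pen2_large : \forall n \near \oo, x + 1 <= pen 2%N n - pen 1%N n.
  by have /cvgryPge := pen_oo 2%N isT; exact.
have n_large : \forall n \near \oo, (x + 1) / c <= n%:R.
  by have /cvgryPge := @cvgr_idn R; exact.
near=> n.
have n0 : (0 < n)%N by near: n; exact: nbhs_infty_gt.
rewrite measure_ge0 /=; apply: le_measure.
- rewrite inE; apply: measurable_selected_le => k.
  exact: measurable_NT_stat.
- rewrite inE; apply: measurable_mx_norm_ge => // i.
  under eq_fun do rewrite mxE [X in _ + X]mxE.
  by apply: measurable_funB => //; exact: measurable_score_mean.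
move=> w /= Sx; rewrite leNgt; apply/negP => dev.
have dev_entry i : `|mean n w 0 i - mu 0 i| < e.
  by apply: le_lt_trans dev; have := ler_norm_entry (mean n w - mu) i; rewrite !mxE.
suff : x < NT_stat P0 l Y (selection_rule d pen (NT_stat P0 l Y) n w) n w.
  by rewrite ltNge Sx.
have n0' : 0 < n%:R :> R by rewrite ltr0n.
apply: (selected_stat_gt (K := K) (g := c * n%:R)).
- by move=> i j; exact: pen_mono.
- by rewrite hK; near: n.
- rewrite -ltr_pdivrMl// mulrC.
  apply: (@lt_le_trans _ _ ((x + 1) / c)); last by near: n.
  by rewrite ltr_pM2r ?invr_gt0// ltrDl.
- by rewrite mulr_gt0.
- by apply: (@lt_le_trans _ _ (x + 1)); [rewrite ltrDl|near: n].
- exact: NT_stat_ge0.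
- apply: le_trans (TK_ge n w n0).
  rewrite ler_wpM2r// ler_wpM2l ?(ltW b0)//.
  have muK : mu 0 iK = C by rewrite mxE prednK.
  have := dev_entry iK; rewrite muK -/(mean n w) lt_min => /andP[dK' _].
  rewrite -[leLHS]real_normK ?num_real// -[leRHS]real_normK ?num_real//.
  rewrite lerXn2r ?nnegrE// normrM (ger0_norm (_ : 0 <= 2^-1 :> R)) ?invr_ge0//.
  have := lerB_dist C (C - mean n w 0 iK).
  by rewrite subKr distrC; lra.
- move=> K1; rewrite NT_stat1E//.
  have mu1 : mu 0 i1 = 0 by rewrite mxE hE0.
  have -> : score_mean l Y 1 n w 0 0 = mean n w 0 i1.
    by rewrite /mean !score_meanE.
  have := dev_entry i1; rewrite mu1 subr0 !lt_min => /and3P[_ m1 mL].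
  rewrite [leLHS]mulrC [leRHS]mulrAC ler_pM2r//.
  rewrite -[X in X * _]real_normK ?num_real//.
  apply: (@le_trans _ _ (`|mean n w 0 i1| * (`|L1| + 1))); last first.
    by rewrite -ler_pdivlMr// ltW.
  rewrite (le_trans (ler_norm _))// normrM ger0_norm ?exprn_ge0//.
  apply: ler_pM => //; last by rewrite lerDl.
  by rewrite expr2 ler_piMr// ltW.
- by rewrite mulrAC; near: n.
- by rewrite mulrAC; near: n.
Unshelve. all: end_near. Qed.
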